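(* Let $n\ge1$ and $d\ge2$ be integers, $d_0=\gcd(n,d)$ and $n_1=n/d_0$. (i) The kernel of multiplication by $d$ on $\Sigma(n,d)$ is isomorphic to $\mathbb{Z}_d^{\,n-n_1}$. (ii) The kernel of multiplication by $d$ on $S(n,d)$ is isomorphic to $\mathbb{Z}_{d/d_0}\oplus\mathbb{Z}_d^{\,n-n_1-1}$.
   Context: In $\mathbb{Q}[x]/(x^n-1)$ (exponents mod $n$) put $e_v=x^v-1$, $\epsilon_v=d\,e_v-e_{dv}$; $\mathcal Z_n$ = $\mathbb{Z}$-span of $e_1,\dots,e_{n-1}$, $\mathcal E_{n,d}$ = $\mathbb{Z}$-span of $\epsilon_1,\dots,\epsilon_{n-1}$, $\Sigma(n,d)=\mathcal Z_n/\mathcal E_{n,d}$. With $f_v=dx^v-\sum_{i=0}^{d-1}x^{dv+i}$, $S(n,d)=\mathcal Z_n/\langle f_1,\dots,f_{n-1}\rangle_{\mathbb{Z}}$ (the sandpile group of the generalized de Bruijn graph $\mathrm{DB}(n,d)$).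
   Formalization: In (ii), when gcd(n,d)=1 the exponent n−n_1−1 equals −1 and the right-hand side is undefined; there the kernel on S(n,d) is stated to be trivial, and the displayed formula is stated for gcd(n,d)>1. *)

(* Defs.v *)
From HB Require Import structures.
From mathcomp Require Import all_boot all_order all_algebra.

Set Implicit Arguments.
Unset Strict Implicit.
Unset Printing Implicit Defensive.

Import GRing.Theory.
Local Open Scope ring_scope.

Section IntSpan.
Variables (vT : vectType rat) (m : nat) (s : m.-tuple vT).

(* Boolean form of inIntSpan, as needed to form subtypes and quotients. *)
Definition int_span : {pred vT} := fun v => dec_Qint_span s v.

Lemma int_spanP v : reflect (inIntSpan s v) (v \in int_span).
Proof. exact: sumboolP. Qed.

Lemma int_span_zmod_closed : zmod_closed int_span.
Proof.
split=> [|u v /int_spanP[a ->] /int_spanP[b ->]]; apply/int_spanP.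
  by exists [ffun=> 0]; rewrite big1 // => i _; rewrite ffunE mulr0z.
exists [ffun i => a i - b i]; rewrite -sumrB.
by apply: eq_bigr => i _; rewrite ffunE mulrzBr.
Qed.

HB.instance Definition _ :=
  GRing.isZmodClosed.Build vT int_span int_span_zmod_closed.

Definition int_span_of := {v : vT | v \in int_span}.
HB.instance Definition _ := SubChoice.on int_span_of.
HB.instance Definition _ := [SubChoice_isSubZmodule of int_span_of by <:].

End IntSpan.

Section SpanQuotient.
Variables (vT : vectType rat) (k m : nat) (s : k.-tuple vT) (t : m.-tuple vT).

(* The span of t, viewed inside the span of s; below t always lies in the
   span of s (lemmas eps_in_Zn and f_in_Zn). *)
Definition span_in : {pred int_span_of s} := fun u => val u \in int_span t.

Lemma span_in_zmod_closed : zmod_closed span_in.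
Proof.
split=> [|u v]; first exact: (rpred0 (int_span t)).
exact: (@rpredB _ (int_span t)).
Qed.

HB.instance Definition _ :=
  GRing.isZmodClosed.Build (int_span_of s) span_in span_in_zmod_closed.

Definition span_quot : zmodType := Quotient.quot span_in.

End SpanQuotient.

Section MulKernel.
Variables (G : zmodType) (d : nat).

Definition mul_ker_pred : {pred G} := fun x => x *+ d == 0.

Lemma mul_ker_zmod_closed : zmod_closed mul_ker_pred.
Proof.
split=> [|x y]; rewrite !unfold_in ?mul0rn // => /eqP x0 /eqP y0.
by rewrite /mul_ker_pred mulrnBl x0 y0 subr0.
Qed.

HB.instance Definition _ :=
  GRing.isZmodClosed.Build G mul_ker_pred mul_ker_zmod_closed.

Definition mul_ker := {x : G | x \in mul_ker_pred}.
HB.instance Definition _ := SubChoice.on mul_ker.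
HB.instance Definition _ := [SubChoice_isSubZmodule of mul_ker by <:].

End MulKernel.

Definition zmod_isog (A B : zmodType) : Prop :=
  exists f : {additive A -> B}, bijective f.

(* Z/k for every k >= 1, including the trivial group for k = 1; the library's
   'Z_k would be Z/2 there. *)
Notation cyc k := 'I_k.-1.+1.

Section DeBruijn.
Variables n d : nat.

Definition cycR := {poly %/ ('X^n - 1 : {poly rat})}.
HB.instance Definition _ := GRing.ComNzRing.on cycR.
HB.instance Definition _ := Vector.on cycR.

Definition cycX : cycR := 'qX.

Definition e_ v : cycR := cycX ^+ v - 1.
Definition eps_ v : cycR := e_ v *+ d - e_ (d * v).
Definition f_ v : cycR :=
  cycX ^+ v *+ d - \sum_(0 <= i < d) cycX ^+ (d * v + i).

Definition e_tuple : n.-1.-tuple cycR := [tuple e_ i.+1 | i < n.-1].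
Definition eps_tuple : n.-1.-tuple cycR := [tuple eps_ i.+1 | i < n.-1].
Definition f_tuple : n.-1.-tuple cycR := [tuple f_ i.+1 | i < n.-1].

Definition Zn := int_span e_tuple.
Definition Sigma : zmodType := span_quot e_tuple eps_tuple.
Definition Sand : zmodType := span_quot e_tuple f_tuple.

Lemma cycX_expn : (0 < n)%N -> cycX ^+ n = 1.
Proof.
move=> n_gt0; rewrite /cycX /qpolyX -rmorphXn /=.
apply/eqP; rewrite -subr_eq0 -(rmorph1 (in_qpoly ('X^n - 1))) -rmorphB /=.
have mon : mk_monic ('X^n - 1 : {poly rat}) = 'X^n - 1.
  by rewrite /mk_monic size_XnsubC // ltnS n_gt0 monicXnsubC.
apply/eqP/val_inj; rewrite /= mon Pdiv.RingMonic.rmodpp //.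
exact: monicXnsubC.
Qed.

Lemma e_in_Zn v : (0 < n)%N -> e_ v \in Zn.
Proof.
move=> n_gt0; have -> : e_ v = e_ (v %% n).
  by rewrite /e_ {1}(divn_eq v n) exprD mulnC exprM cycX_expn // expr1n mul1r.
have := ltn_pmod v n_gt0; case: (v %% n)%N => [_|k lt_k].
  by rewrite /e_ expr0 subrr rpred0.
have k_lt : (k < n.-1)%N by rewrite -ltnS prednK.
apply/int_spanP; exists [ffun i => (i == Ordinal k_lt)%:Z].
rewrite (bigD1 (Ordinal k_lt)) //= ffunE eqxx mulr1z big1 => [|i /negPf ne_i].
  by rewrite addr0 (nth_mktuple _ 0 (Ordinal k_lt)).
by rewrite ffunE ne_i mulr0z.
Qed.

Lemma eps_in_Zn v : (0 < n)%N -> eps_ v \in Zn.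
Proof. by move=> n_gt0; rewrite rpredB ?rpredMn ?e_in_Zn. Qed.

Lemma f_in_Zn v : (0 < n)%N -> f_ v \in Zn.
Proof.
move=> n_gt0.
have -> : f_ v = e_ v *+ d - \sum_(0 <= i < d) e_ (d * v + i).
  rewrite /f_ sumrB big_const_nat subn0 iter_addr_0 mulrnBl opprB.
  by rewrite addrA subrK.
by rewrite rpredB ?rpredMn ?rpred_sum // => [|i _]; rewrite e_in_Zn.
Qed.

End DeBruijn.

(* Main.v *)
(* Let Y = Z^n and let F : Y -> Q[x]/(x^n - 1) send the v-th basis vector to
   eps_v (resp. f_v); its image is the lattice of relations.  If d x = F y with
   x in Z_n, then the class of x modulo the relations determines y modulo
   d Y + ker F and conversely, so the kernel of multiplication by d is
   { y | F y \in d Z_n } / (d Y + ker F).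
   Modulo d, F y is determined by the sums of y over the classes mod n1 (this
   is where gcd(d/d0, n1) = 1 enters): for eps the condition is that the sums
   over the nonzero classes vanish mod d, for f it is that all class sums agree
   mod d and are divisible by d0.  Solving for the entries y_0, ..., y_(n1-1)
   leaves the entries of index at least n1 as free coordinates.
   Finally ker F is spanned by the basis vector 0, resp. by the all-ones vector:
   x |-> x^d cannot increase the l1-norm, hence has no eigenvalue d. *)
Require Import Defs.
From HB Require Import structures.
From mathcomp Require Import all_boot all_order all_algebra.

Set Implicit Arguments.
Unset Strict Implicit.
Unset Printing Implicit Defensive.

Import Order.TTheory GRing.Theory Num.Theory.
Local Open Scope ring_scope.

(** * Kernel of multiplication by d on a quotient of lattices *)

Lemma mulrIn_vect (vT : vectType rat) d : (0 < d)%N ->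
  injective (fun x : vT => x *+ d).
Proof.
move=> d_gt0 x y /eqP; rewrite -!scaler_nat -subr_eq0 -scalerBr scaler_eq0.
by rewrite pnatr_eq0 -leqn0 leqNgt d_gt0 subr_eq0 => /eqP.
Qed.

(* The isomorphism sends the class of x to h y, where x *+ d = F y. *)
Lemma mul_ker_isog (vT : vectType rat) (k m : nat) (s : k.-tuple vT)
    (t : m.-tuple vT) (d : nat) (Y B : zmodType) (F : {additive Y -> vT})
    (P : Y -> Prop) (h : Y -> B) :
  (0 < d)%N ->
  (forall x, x \in int_span t <-> exists y, x = F y) ->
  (forall y, P y <-> exists2 x, x \in int_span s & F y = x *+ d) ->
  (forall y z, P y -> P z -> h (y - z) = h y - h z) ->
  (forall y, P y -> h y = 0 <-> exists z, F y = F z *+ d) ->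
  (forall b, exists2 y, P y & h y = b) ->
  zmod_isog (mul_ker (span_quot s t) d) B.
Proof.
move=> d_gt0 tE PE hB h0 h_surj.
pose Q := Quotient.quot (@span_in vT k m s t).
pose piQ : {additive int_span_of s -> Q} := \pi_Q%qT.
have piE0 u : (piQ u == 0) = (val u \in int_span t).
  by rewrite -[0](raddf0 piQ) /piQ /= -Quotient.idealrBE subr0.
have reprQ (q : span_quot s t) : piQ (repr (q : Q)) = q by exact: reprK.
(* Taking representatives is additive only modulo the span of [t]; d times this defect has the form
   [F z *+ d], which [h] kills. *)
pose rep (x : mul_ker (span_quot s t) d) : vT := val (repr (val x : Q)).
have rep_s x : rep x \in int_span s by exact: valP.
have rep_t x : rep x *+ d \in int_span t.
  have : val x *+ d == 0 by exact: (valP x).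
  by rewrite -[val x]reprQ -raddfMn piE0 raddfMn.
have repB x y : rep x - rep y - rep (x - y) \in int_span t.
  by rewrite /rep -!raddfB -piE0 !raddfB !reprQ -!raddfB subrr.
have rep_inj x y : rep x - rep y \in int_span t -> x = y.
  rewrite /rep -raddfB -piE0 raddfB !reprQ subr_eq0 => /eqP; exact: val_inj.
have exY x : exists y, F y == rep x *+ d.
  by have /tE[y ->] := rep_t x; exists y.
pose g x := xchoose (exY x).
have gE x : F (g x) = rep x *+ d by exact/eqP/(xchooseP (exY x)).
have gP x : P (g x) by apply/PE; exists (rep x).
have PB y z : P y -> P z -> P (y - z).
  move=> /PE[a sa Fa] /PE[b sb Fb].
  apply/PE; exists (a - b); first exact: rpredB.
  by rewrite raddfB Fa Fb mulrnBl.
have h_addM : zmod_morphism (h \o g).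
  move=> x y /=; have /tE[z Ez] := repB x y.
  apply/esym/eqP; rewrite -subr_eq0 -!hB //; last exact: PB.
  apply/eqP/h0; first by apply: (PB); first exact: PB.
  by exists z; rewrite !raddfB !gE -Ez !mulrnBl.
have h_inj : injective (h \o g).
  (* If [h] identifies the two, d ([rep x] - [rep y]) equals d [F z], and d cancels because the
     ambient space is torsion-free. *)
  move=> x y /= /eqP; rewrite -subr_eq0 -hB // => /eqP/h0[|z]; first exact: PB.
  rewrite raddfB !gE -mulrnBl => /(mulrIn_vect d_gt0) Ez.
  by apply: rep_inj; apply/tE; exists z.
have h_onto b : exists x, h (g x) == b.
  have [y Py <-] := h_surj b; have /PE[a sa Fa] := Py.
  pose u : int_span_of s := Sub a sa.
  have kera : piQ u \in @mul_ker_pred (span_quot s t) d.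
    rewrite unfold_in /mul_ker_pred -(raddfMn piQ) piE0 raddfMn.
    rewrite [X in X *+ d](_ : _ = a) // -Fa.
    by apply/tE; exists y.
  exists (Sub (piQ u) kera); set x := Sub _ _.
  rewrite -subr_eq0 -hB //; apply/eqP/h0; first exact: PB.
  have : rep x - a \in int_span t.
    by rewrite /rep -[a]/(val u) -raddfB -piE0 raddfB reprQ SubK subrr.
  by case/tE => z Ez; exists z; rewrite raddfB gE Fa -mulrnBl Ez.
pose hM := GRing.isZmodMorphism.Build _ _ (h \o g) h_addM.
pose hA : {additive mul_ker (span_quot s t) d -> B} := HB.pack (h \o g) hM.
exists hA; exists (fun b => xchoose (h_onto b)) => [x|b].
  by apply: h_inj; apply/eqP; exact: (xchooseP (h_onto _)).
exact/eqP/(xchooseP (h_onto b)).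
Qed.

(** * Integer combinations as images of Z^n *)

Section IntComb.
Variables (V : zmodType) (n : nat) (t : nat -> V).

Definition int_comb (y : {ffun 'I_n -> int}) : V := \sum_(v < n) t v *~ y v.

Lemma int_comb_is_zmod_morphism : zmod_morphism int_comb.
Proof.
move=> y z; rewrite /int_comb -sumrB; apply: eq_bigr => v _.
by rewrite !ffunE mulrzBr.
Qed.

HB.instance Definition _ :=
  GRing.isZmodMorphism.Build _ _ int_comb int_comb_is_zmod_morphism.

End IntComb.

(** The generator of index 0, missing from the tuple, lies in the span of the others, so all
    residues modulo n may serve as indices. *)
Lemma int_span_comb (vT : vectType rat) (n : nat) (t : nat -> vT) x :
  t 0%N \in int_span [tuple t i.+1 | i < n] ->
  x \in int_span [tuple t i.+1 | i < n] <->
    exists y : {ffun 'I_n.+1 -> int}, x = int_comb t y.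
Proof.
set s := [tuple _ | _ < _] => t0; split=> [/int_spanP[a ->]|[y ->]].
  exists [ffun v => if unlift ord0 v is Some i then a i else 0].
  rewrite /int_comb big_ord_recl ffunE unlift_none mulr0z add0r.
  by apply: eq_bigr => i _; rewrite ffunE liftK (nth_mktuple _ 0 i).
rewrite /int_comb big_ord_recl rpredD ?rpredMz //.
apply/int_spanP; exists [ffun i => y (lift ord0 i)].
by apply: eq_bigr => i _; rewrite ffunE (nth_mktuple _ 0 i).
Qed.

Lemma sum_block (V : nmodType) (F : nat -> V) a b :
  \sum_(0 <= i < a * b) F i =
  \sum_(0 <= v < b) \sum_(0 <= i < a) F (a * v + i)%N.
Proof.
elim: b => [|b IHb]; first by rewrite muln0 !big_geq.
rewrite mulnS addnC big_nat_recr //= -IHb.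
rewrite (@big_cat_nat _ _ _ (a * b)) ?leq_addr //=.
congr (_ + _); rewrite -{1}[(a * b)%N]add0n big_addn addKn.
by apply: eq_bigr => i _; rewrite addnC.
Qed.

(** * Integral elements of Q[x]/(x^n - 1) and their coordinates *)

Section CyclicAlgebra.
Variable n' : nat.
Local Notation n := n'.+1.
Local Notation X := (cycX n).
Implicit Types y z : {ffun 'I_n -> int}.

Definition cyc_elt := int_comb (n := n) (fun v => X ^+ v).
HB.instance Definition _ := GRing.Additive.on cyc_elt.

Lemma cycX_expn_mod k : X ^+ (k %% n) = X ^+ k.
Proof.
by rewrite {2}(divn_eq k n) exprD mulnC exprM cycX_expn // expr1n mul1r.
Qed.

(** The representative of degree less than n, from which coordinates are read off. *)
Definition cyc_poly (x : cycR n) : {poly rat} := val x.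

Lemma cyc_poly_is_zmod_morphism : zmod_morphism cyc_poly.
Proof. by []. Qed.

HB.instance Definition _ :=
  GRing.isZmodMorphism.Build _ _ cyc_poly cyc_poly_is_zmod_morphism.

Lemma cyc_poly_expn (v : 'I_n) : cyc_poly (X ^+ v) = 'X^v.
Proof.
have monE : mk_monic ('X^n - 1 : {poly rat}) = 'X^n - 1.
  by rewrite /mk_monic size_XnsubC // monicXnsubC.
rewrite /cyc_poly /cycX /qpolyX -rmorphXn /= monE Pdiv.Ring.rmodp_small //.
by rewrite size_XnsubC // size_polyXn ltnS ltn_ord.
Qed.

Lemma cyc_poly_elt y : cyc_poly (cyc_elt y) = \poly_(v < n) (y (inord v))%:~R.
Proof.
rewrite /cyc_elt /int_comb raddf_sum poly_def; apply: eq_bigr => v _.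
by rewrite raddfMz /= cyc_poly_expn inord_val -scaler_int.
Qed.

Lemma cyc_elt_inj : injective cyc_elt.
Proof.
move=> y z Eyz; apply/ffunP => v.
have := congr1 (fun x => (cyc_poly x)`_v) Eyz.
by rewrite /= !cyc_poly_elt !coef_poly ltn_ord inord_val => /intr_inj.
Qed.

(** Z_n is the augmentation ideal of Z[x]/(x^n - 1): evaluation at 1 kills each e_v, and conversely
    y = sum y_v (x^v - 1) when the y_v add up to 0. *)
Lemma cyc_elt_in_Zn y : (cyc_elt y \in @Zn n) = (\sum_v y v == 0).
Proof.
pose aug (x : cycR n) : rat := (cyc_poly x).[1].
have augE z : aug (cyc_elt z) = (\sum_v z v)%:~R.
  rewrite /aug cyc_poly_elt horner_poly rmorph_sum; apply: eq_bigr => v _.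
  by rewrite expr1n mulr1 inord_val.
apply/idP/eqP => [/int_spanP[a Ea]|y0].
  apply: (@intr_inj rat); rewrite -augE Ea /aug.
  rewrite raddf_sum horner_sum big1 // => i _.
  rewrite raddfMz hornerMz (nth_mktuple _ 0 i) /e_ raddfB /=.
  rewrite (cyc_poly_expn (lift ord0 i)) -(expr0 X) (cyc_poly_expn ord0).
  by rewrite !hornerE !expr1n subrr mul0rz.
have -> : cyc_elt y = \sum_(v < n) e_ n v *~ y v.
  rewrite /cyc_elt /int_comb.
  under [RHS]eq_bigr do rewrite /e_ mulrzBl.
  by rewrite sumrB -mulrz_sumr y0 mulr0z subr0.
by apply: rpred_sum => v _; rewrite rpredMz ?e_in_Zn.
Qed.

Lemma cyc_elt_Zn x : x \in @Zn n -> exists y, x = cyc_elt y.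
Proof.
case/int_spanP=> a ->.
elim/big_ind: _ => [|x1 x2 [y ->] [z ->]|i _].
- by exists 0; rewrite raddf0.
- by exists (y + z); rewrite raddfD.
rewrite (nth_mktuple _ 0 i) /e_.
exists ([ffun v => if v == lift ord0 i then a i else 0] -
        [ffun v => if v == ord0 then a i else 0]).
have single (u : 'I_n) :
    cyc_elt [ffun v => if v == u then a i else 0] = X ^+ u *~ a i.
  rewrite /cyc_elt /int_comb (bigD1 u) //= big1 ?addr0 ?ffunE ?eqxx //.
  by move=> v /negPf v_u; rewrite ffunE v_u mulr0z.
by rewrite raddfB /= !single mulrzBl expr0.
Qed.

(** The powers of x are independent, so division by d is coordinatewise, and the quotient keeps
    coordinate sum 0. *)
Lemma cyc_elt_dvd_Zn d y : (0 < d)%N -> cyc_elt y \in @Zn n ->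
  (exists2 x, x \in @Zn n & cyc_elt y = x *+ d) <-> forall w, (d %| y w)%Z.
Proof.
move=> d_gt0; rewrite cyc_elt_in_Zn => /eqP y0.
split=> [[x /cyc_elt_Zn[z ->]]|dvd_y].
  rewrite -raddfMn => /cyc_elt_inj -> w.
  by rewrite ffunMnE -mulr_natr dvdz_mull ?natz ?dvdzz.
pose z := [ffun w => (y w %/ d)%Z].
have yE : y = z *+ d.
  apply/ffunP => w; rewrite ffunMnE ffunE -mulr_natr natz divzK //.
exists (cyc_elt z); last by rewrite -raddfMn -yE.
rewrite cyc_elt_in_Zn; move: y0; rewrite yE.
under eq_bigr do rewrite ffunMnE.
by rewrite sumrMnl => /eqP; rewrite mulrn_eq0 eqn0Ngt d_gt0.
Qed.

Lemma cyc_elt_push (k : 'I_n -> nat) y :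
  \sum_(v < n) X ^+ k v *~ y v =
  cyc_elt [ffun w : 'I_n => \sum_(v < n | k v == w %[mod n]) y v].
Proof.
rewrite /cyc_elt /int_comb.
rewrite (partition_big (fun v => inZp (k v) : 'I_n) xpredT) //=.
apply: eq_bigr => w _; rewrite ffunE mulrz_sumr; apply: eq_big => v /=.
  by rewrite -val_eqE /= (modn_small (ltn_ord w)).
by move=> /eqP <- /=; rewrite cycX_expn_mod.
Qed.

End CyclicAlgebra.

(* The l1-norm of u over A would have to grow by the factor d. *)
Lemma contraction_eq0 (I : finType) (A : pred I) (g : I -> I) (u : I -> int)
    (d : nat) :
  (1 < d)%N ->
  (forall w, A w -> u w *+ d = \sum_(v | A v && (g v == w)) u v) ->
  forall w, A w -> u w = 0.
Proof.
move=> d_gt1 uE.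
have le_sum : (\sum_(w | A w) `|u w|) *+ d <= \sum_(w | A w) `|u w|.
  pose N := \sum_(w | A w) \sum_(v | A v && (g v == w)) `|u v|.
  rewrite -sumrMnl (le_trans (y := N)) // {}/N.
    by apply: ler_sum => w Aw; rewrite -normrMn uE // ler_norm_sum.
  rewrite (exchange_big_dep A) //=; last by move=> w v _ /andP[].
  (* The term [|u v|] is counted only at w = [g v], hence at most once, and not at all if [g v] lies
     outside [A]. *)
  apply: ler_sum => v Av.
  have [Agv|nAgv] := boolP (A (g v)).
    rewrite (bigD1 (g v)) /=; last by rewrite Agv Av eqxx.
    by rewrite big1 ?addr0 // => w /andP[/and3P[_ _ /eqP->]]; rewrite eqxx.
  by rewrite big1 // => w /and3P[Aw _ /eqP gvw];
    rewrite -gvw (negPf nAgv) in Aw.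
have sum_ge0 : 0 <= \sum_(w | A w) `|u w| by apply: sumr_ge0.
have norm0 (N : int) : 0 <= N -> N *+ d <= N -> N = 0.
  case: d d_gt1 {uE le_sum} => [|[|e]] // _ N_ge0; rewrite mulrS gerDl => le0.
  by apply/eqP; rewrite eq_le N_ge0 andbT -(pmulrn_lle0 N (ltn0Sn e)).
have u0 := psumr_eq0P (fun w _ => normr_ge0 (u w)) (norm0 _ sum_ge0 le_sum).
by move=> w Aw; apply/normr0_eq0/u0.
Qed.

(** * Sums over windows of consecutive integers *)

Lemma window_shift (V : nmodType) (f : nat -> V) w d :
  \sum_(0 <= j < d) f (w.+1 + j)%N + f w =
  \sum_(0 <= j < d) f (w + j)%N + f (w + d)%N.
Proof.
rewrite -(big_nat_recr d 0 (fun j => f (w + j)%N)) //=.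
rewrite big_nat_recl // addn0 addrC.
by congr (_ + _); apply: eq_bigr => j _; rewrite addSnnS.
Qed.

(** Sliding the window by one trades w for w + k q, which has the same residue modulo k, so only the
    window at 0 has to be counted. *)
Lemma sum_window_dvdn k q w : (0 < k)%N ->
  \sum_(0 <= j < k * q) (k %| w + j)%:R = q%:R :> int.
Proof.
move=> k_gt0; elim: w => [|w IHw].
  under eq_bigr do rewrite add0n.
  rewrite (sum_block (fun j => (k %| j)%:R)).
  rewrite (eq_bigr (fun=> 1)) => [|v _].
    by rewrite big_const_nat subn0 iter_addr_0.
  rewrite big_ltn // addn0 dvdn_mulr // big_nat.
  rewrite big1 ?addr0 // => i /andP[i_gt0 i_lt].
  by rewrite dvdn_addr ?dvdn_mulr // gtnNdvd.
have := window_shift (fun j => (k %| j)%:R : int) w (k * q).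
rewrite IHw (dvdn_addl _ (dvdn_mulr q (dvdnn k))).
exact: addIr.
Qed.

(** * Class sums modulo n1 and divisibility by d *)

Section ClassSums.
Variables n' d : nat.
Hypothesis d_gt0 : (0 < d)%N.
Local Notation n := n'.+1.
Local Notation d0 := (gcdn n d).
Local Notation n1 := (n %/ d0)%N.
Local Notation m := (d %/ d0)%N.
Implicit Types y z : {ffun 'I_n -> int}.

Definition class_sum y (a : nat) : int := \sum_(v < n | v == a %[mod n1]) y v.
(** The coefficient of x^w in y(x^d), for y(x) = sum y_v x^v. *)
Definition preim_sum y (w : nat) : int :=
  \sum_(v < n | d * v == w %[mod n]) y v.
(** The coefficient of x^w in y(x^d) (1 + x + ... + x^(d-1)). *)
Definition window_sum y (w : nat) : int :=
  \sum_(0 <= i < d) \sum_(v < n | d * v + i == w %[mod n]) y v.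

Lemma d0_gt0 : (0 < d0)%N. Proof. by rewrite gcdn_gt0. Qed.
Lemma mul_n1 : (d0 * n1 = n)%N. Proof. by rewrite mulnC divnK ?dvdn_gcdl. Qed.
Lemma mul_m : (d0 * m = d)%N. Proof. by rewrite mulnC divnK ?dvdn_gcdr. Qed.
Lemma n1_gt0 : (0 < n1)%N.
Proof. by have := ltn0Sn n'; rewrite -{1}mul_n1 muln_gt0 => /andP[]. Qed.
Lemma n1_le : (n1 <= n)%N. Proof. exact: leq_div. Qed.
Lemma coprime_n1_m : coprime n1 m.
Proof.
by rewrite /coprime -(eqn_pmul2l d0_gt0) muln_gcdr mul_n1 mul_m muln1.
Qed.

(** Dividing by d0 leaves n1 | m (v - a), and m is coprime to n1. *)
Lemma eqn_mod_mul v a : (d * v == d * a %[mod n]) = (v == a %[mod n1]).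
Proof.
wlog le_av : v a / (a <= v)%N => [IH|].
  by case/orP: (leq_total a v) => /IH // IHav; rewrite eq_sym IHav eq_sym.
rewrite !eqn_mod_dvd ?leq_mul2l ?le_av ?orbT // -mulnBr.
rewrite -[X in (X %| _)%N]mul_n1 -[X in (_ %| X * _)%N]mul_m.
rewrite -mulnA dvdn_pmul2l ?d0_gt0 //.
by rewrite Gauss_dvdr ?coprime_n1_m.
Qed.

Lemma preim_sum_mul y a : preim_sum y (d * a) = class_sum y a.
Proof. by apply: eq_bigl => v; rewrite eqn_mod_mul. Qed.

Lemma eq_preim_sum y w w' : w = w' %[mod n] -> preim_sum y w = preim_sum y w'.
Proof. by move=> Eww; apply: eq_bigl => v; rewrite Eww. Qed.

Lemma eq_window_sum y w w' :
  w = w' %[mod n] -> window_sum y w = window_sum y w'.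
Proof.
by move=> Eww; apply: eq_bigr => i _; apply: eq_bigl => v; rewrite Eww.
Qed.

Lemma eq_class_sum y a b : a = b %[mod n1] -> class_sum y a = class_sum y b.
Proof. by move=> Eab; apply: eq_bigl => v; rewrite Eab. Qed.

Lemma preim_sum_ndvd y w : ~~ (d0 %| w)%N -> preim_sum y w = 0.
Proof.
move=> ndvd_w; rewrite /preim_sum big1 // => v /eqP Evw; case/negP: ndvd_w.
rewrite /dvdn -(modn_dvdm w (dvdn_gcdl n d)) -Evw modn_dvdm ?dvdn_gcdl //.
exact: dvdn_mulr (dvdn_gcdr n d).
Qed.

(** By Bezout, some multiple of d is congruent to d0 modulo n. *)
Lemma dvdn_gcd_mul w : (d0 %| w)%N -> exists a, d * a = w %[mod n].
Proof.
case/dvdnP=> q ->; case: (egcdnP n d_gt0) => km kn Ekm _.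
exists (km * q)%N; rewrite mulnA [(d * km)%N]mulnC Ekm mulnDl mulnAC modnMDl.
by rewrite gcdnC mulnC.
Qed.

(** The substitution j = d - 1 - i; the shift of w by d keeps w + d - i a natural number. *)
Lemma window_sumE y w :
  window_sum y (w + d) = \sum_(0 <= j < d) preim_sum y (w.+1 + j).
Proof.
rewrite /window_sum big_nat_rev /= !big_nat; apply: eq_bigr => j /= lt_jd.
apply: eq_bigl => v; rewrite add0n -(eqn_modDr j.+1) -addnA subnK //.
by rewrite addnAC eqn_modDr addSnnS.
Qed.

(** Coefficient form of (x - 1)(1 + ... + x^(d-1)) = x^d - 1. *)
Lemma window_sum_shift y w :
  window_sum y (w.+1 + d) + preim_sum y w.+1 =
  window_sum y (w + d) + preim_sum y (w.+1 + d).
Proof. by rewrite !window_sumE window_shift. Qed.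

Lemma class_sum_split y (a : 'I_n) : (a < n1)%N ->
  class_sum y a = y a + \sum_(v < n | (v == a %[mod n1]) && (n1 <= v)%N) y v.
Proof.
move=> lt_a; rewrite /class_sum (bigD1 a) //=; congr (_ + _).
apply: eq_bigl => v; case: eqP => //= Eva.
rewrite leqNgt; congr negb; apply/eqP/idP => [->//|lt_v].
by apply: val_inj; rewrite /= -(modn_small lt_v) Eva modn_small.
Qed.

Lemma class_sum_dvd (k : int) y :
  (forall v : 'I_n, (n1 <= v)%N -> (k %| y v)%Z) ->
  forall a : 'I_n, (a < n1)%N -> (k %| class_sum y a)%Z = (k %| y a)%Z.
Proof.
move=> dvd_y a lt_a; rewrite class_sum_split // rpredDr //.
by apply: rpred_sum => v /andP[_ /dvd_y].
Qed.

(** Each class modulo n1 has exactly one index below n1; its entry is solved for from the prescribed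
    sum. *)
Lemma class_sum_complete (s r : nat -> int) :
  exists y, (forall v : 'I_n, (n1 <= v)%N -> y v = r v) /\
            (forall a, (a < n1)%N -> class_sum y a = s a).
Proof.
pose y : {ffun 'I_n -> int} := [ffun v : 'I_n => if (v < n1)%N
  then s v - \sum_(u < n | (u == v %[mod n1]) && (n1 <= u)%N) r u else r v].
have yr (v : 'I_n) : (n1 <= v)%N -> y v = r v by rewrite ffunE ltnNge => ->.
exists y; split=> // a lt_a.
have lt_an := leq_trans lt_a n1_le.
rewrite -[a]/(val (Ordinal lt_an)) class_sum_split // {1}/y ffunE /= lt_a.
rewrite -addrA [X in _ + X](_ : _ = 0) ?addr0 //.
rewrite addrC; apply/eqP; rewrite subr_eq0; apply/eqP.
by apply: eq_bigr => v /andP[_ /yr].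
Qed.

Lemma class_sum_const (c : int) a : class_sum [ffun=> c] a = c *+ d0.
Proof.
rewrite /class_sum; under eq_bigr do rewrite ffunE.
rewrite big_mkcond.
rewrite -(big_mkord xpredT (fun v => if v == a %[mod n1] then c else 0)) /=.
rewrite -{1}mul_n1 mulnC sum_block (eq_bigr (fun=> c)) => [|v _].
  by rewrite big_const_nat subn0 iter_addr_0.
rewrite big_mkord (bigD1 (Ordinal (ltn_pmod a n1_gt0))) //= big1 => [|i].
  by rewrite mulnC modnMDl modn_mod eqxx addr0.
by rewrite -val_eqE /= mulnC modnMDl (modn_small (ltn_ord i)) => /negPf->.
Qed.

Lemma class_sum_is_zmod_morphism a : zmod_morphism (class_sum^~ a).
Proof.
by move=> y z; rewrite /class_sum -sumrB; apply: eq_bigr => v _; rewrite !ffunE.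
Qed.

(** Modulo n, a residue w that d0 does not divide has no preimage under v |-> d v. Otherwise w = d
    a, the preimages form the class of a modulo n1, and w = 0 exactly when n1 divides a. *)
Lemma dvd_preim_sums y :
  (forall w : 'I_n, w != ord0 -> (d %| preim_sum y w)%Z) <->
  (forall a, ~~ (n1 %| a)%N -> (d %| class_sum y a)%Z).
Proof.
split=> dvd_y => [a ndvd_a|w w_neq0].
  have := dvd_y (inZp (d * a)).
  rewrite (@eq_preim_sum y _ (d * a)) ?preim_sum_mul /= ?modn_mod //; apply.
  rewrite -val_eqE /= -(modn_small (ltn0Sn n')) -[0%N](muln0 d) eqn_mod_mul.
  by rewrite mod0n.
have [/dvdn_gcd_mul[a Ea]|/preim_sum_ndvd->] := boolP (d0 %| w)%N;
  last exact: dvdz0.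
rewrite -(eq_preim_sum y Ea) preim_sum_mul dvd_y //.
apply: contra w_neq0 => n1a; rewrite -val_eqE /= -(modn_small (ltn_ord w)) -Ea.
by rewrite -(modn_small (ltn0Sn n')) -[0%N](muln0 d) eqn_mod_mul mod0n.
Qed.

(** A window of d = d0 m residues meets m multiples of d0, so if all class sums agree with s modulo
    d, each window sum is m s modulo d, and d | m s means d0 | s. Conversely, differences of
    successive window sums give differences of successive class sums. *)
Lemma dvd_window_sums y :
  (forall w : 'I_n, (d %| window_sum y w)%Z) <->
  (forall a, (d %| class_sum y a - class_sum y 0)%Z) /\ (d0 %| class_sum y 0)%Z.
Proof.
have window_mod : (forall a, (d %| class_sum y a - class_sum y 0)%Z) ->
    forall w, (d %| window_sum y (w + d) - class_sum y 0 * m%:Z)%Z.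
  move=> dvd_y w; rewrite -natz -(sum_window_dvdn m w.+1 d0_gt0) mul_m.
  rewrite window_sumE mulr_sumr -sumrB; apply: rpred_sum => j _.
  have [/dvdn_gcd_mul[a Ea]|/preim_sum_ndvd->] := boolP (d0 %| w.+1 + j)%N.
    by rewrite mulr1 -(eq_preim_sum y Ea) preim_sum_mul.
  by rewrite mulr0 subrr dvdz0.
(* The index grows by n d in total, which brings it into the shifted form [_ + d]. *)
have window_add w : window_sum y w = window_sum y (w + n' * d + d).
  by apply: eq_window_sum; rewrite -addnA -mulSnr addnC mulnC modnMDl.
have dvdm : (d %| class_sum y 0 * m%:Z)%Z = (d0 %| class_sum y 0)%Z.
  have dE : d%:Z = d0%:Z * m%:Z by rewrite -PoszM mul_m.
  rewrite [X in (X %| _)%Z = _]dE dvdz_mul2r //.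
  by have := d_gt0; rewrite -{1}mul_m muln_gt0 => /andP[_]; case: (m).
split=> [dvd_y|[dvd_y dvd0] w]; last first.
  rewrite window_add -(subrK (class_sum y 0 * m%:Z) (window_sum _ _)).
  by rewrite rpredD ?window_mod // dvdm.
have dvd_win w : (d %| window_sum y w)%Z.
  by rewrite -(@eq_window_sum y (inZp w : 'I_n)) ?dvd_y //= modn_mod.
have dvd_class a : (d %| class_sum y a - class_sum y 0)%Z.
  elim: a => [|a IHa]; first by rewrite subrr dvdz0.
  rewrite -(subrKA (class_sum y a)) rpredD //.
  (* As n' + 1 = n, the window starting at n' + d a + 1 loses the residue d a and gains d (a + 1)
     when it slides by one. *)
  have Ea : preim_sum y ((n' + d * a).+1 + d) = class_sum y a.+1.
    rewrite -preim_sum_mul; apply: eq_preim_sum.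
    by rewrite -addSn -addnA -mulnSr modnDl.
  have Ea' : preim_sum y (n' + d * a).+1 = class_sum y a.
    by rewrite -preim_sum_mul; apply: eq_preim_sum; rewrite -addSn modnDl.
  have Eshift := window_sum_shift y (n' + d * a); rewrite Ea Ea' in Eshift.
  have -> : class_sum y a.+1 - class_sum y a =
    window_sum y ((n' + d * a).+1 + d) - window_sum y (n' + d * a + d).
    by apply/eqP; rewrite subr_eq addrAC Eshift addrAC subrr add0r.
  exact: rpredB.
split=> //; rewrite -dvdm -(subrK (window_sum y (0 + d)) (_ * _)).
by rewrite rpredD // -opprB rpredN window_mod.
Qed.

End ClassSums.

(** * Reduction of integers modulo k *)

Section CycInt.
Variable k : nat.
Hypothesis k_gt0 : (0 < k)%N.

Definition cyc_int (z : int) : cyc k := Zp1 *~ z.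

Lemma cyc_intB : zmod_morphism cyc_int.
Proof. by move=> y z; rewrite /cyc_int mulrzBr. Qed.

Lemma cyc_int_eq0 z : (cyc_int z == 0) = (k %| z)%Z.
Proof.
have posE (j : nat) : (Zp1 *+ j == 0 :> cyc k) = (k %| j)%N.
  by rewrite Zp_mulrn -val_eqE /= modnMml mul1n prednK.
by rewrite /cyc_int; case: z => j /=; rewrite ?NegzE ?mulrNz ?oppr_eq0 posE.
Qed.

Lemma cyc_int_surj (b : cyc k) : cyc_int (val b)%:Z = b.
Proof.
rewrite /cyc_int -pmulrn Zp_mulrn; apply: val_inj => /=.
by rewrite modnMml mul1n modn_small.
Qed.

End CycInt.

(** * The two relation maps: divisibility of their values and their kernels *)

Section Kernels.
Variables n' d : nat.
Hypothesis d_gt1 : (1 < d)%N.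
Local Notation n := n'.+1.
Local Notation X := (cycX n).
Local Notation d0 := (gcdn n d).
Local Notation n1 := (n %/ d0)%N.
Local Notation m := (d %/ d0)%N.
Implicit Types y z : {ffun 'I_n -> int}.
Let d_gt0 : (0 < d)%N := ltnW d_gt1.

(** As eps_v = d x^v - x^(d v) - (d - 1), the constants add up to c = (d - 1) sum y_v, which affects
    coordinate 0 only. *)
Lemma int_comb_eps y : exists c,
  int_comb (eps_ n d) y =
  cyc_elt (y *+ d - [ffun w : 'I_n => preim_sum d y w]
           - [ffun w : 'I_n => if w == ord0 then c else 0]).
Proof.
have E0 c : cyc_elt [ffun w : 'I_n => if w == ord0 then c else 0] = 1 *~ c.
  rewrite /cyc_elt /int_comb (bigD1 ord0) //= big1 ?addr0 ?ffunE ?eqxx //.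
  by move=> v /negPf v_neq0; rewrite ffunE v_neq0 mulr0z.
exists ((d%:Z - 1) * \sum_v y v).
rewrite !raddfB raddfMn /= E0 -(cyc_elt_push (fun v => d * v)%N).
rewrite mulrzA mulrz_sumr.
rewrite [cyc_elt y]/int_comb -sumrMnl -!sumrB; apply: eq_bigr => v _.
rewrite mulrzBr -pmulrn mulr1z !pmulrn mulrzAC -!mulrzBl -!pmulrn.
rewrite /eps_ /e_ mulrnBl.
congr (_ *~ _); rewrite !opprB !addrA addrAC [RHS]addrAC.
by congr (_ + _); rewrite addrAC.
Qed.

Lemma int_comb_f y :
  int_comb (f_ n d) y =
  cyc_elt (y *+ d - [ffun w : 'I_n => window_sum d y w]).
Proof.
have -> : [ffun w : 'I_n => window_sum d y w] = \sum_(0 <= i < d)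
    [ffun w : 'I_n => \sum_(v < n | d * v + i == w %[mod n]) y v].
  apply/ffunP => w; rewrite sum_ffunE ffunE.
  by apply: eq_bigr => i _; rewrite ffunE.
rewrite raddfB raddfMn (raddf_sum (@cyc_elt n')) /=.
pose G i := \sum_(v < n) X ^+ (d * v + i) *~ y v.
rewrite [T in _ - T](eq_bigr G); last first.
  by move=> i _; rewrite /G (cyc_elt_push (fun v => d * v + i)%N).
rewrite exchange_big /= [cyc_elt y]/int_comb -sumrMnl -sumrB.
apply: eq_bigr => v _.
by rewrite /f_ mulrzBl mulrz_suml !pmulrn mulrzAC.
Qed.

Lemma int_comb_in_Zn (t : nat -> cycR n) y :
  (forall v, t v \in @Zn n) -> int_comb t y \in @Zn n.
Proof. by move=> tZ; apply: rpred_sum => v _; rewrite rpredMz. Qed.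

(** Modulo d, coordinate w != 0 is minus the preimage sum at w. Coordinate 0, which contains the
    unknown c, follows because the coordinates add up to 0. *)
Lemma dvd_int_comb_eps y :
  (exists2 x, x \in @Zn n & int_comb (eps_ n d) y = x *+ d) <->
  (forall a, ~~ (n1 %| a)%N -> (d %| class_sum d y a)%Z).
Proof.
apply: iff_trans (dvd_preim_sums d_gt0 y); have [c Ec] := int_comb_eps y.
have := @int_comb_in_Zn (eps_ n d) y (fun v => eps_in_Zn d v (ltn0Sn n')).
rewrite {}Ec; set z := _ - _ => zZ.
apply: (iff_trans (cyc_elt_dvd_Zn d_gt0 zZ)).
have zE w : w != ord0 -> (d %| z w)%Z = (d %| preim_sum d y w)%Z.
  move=> /negPf w_neq0; rewrite !ffunE w_neq0 subr0 ffunMnE -mulr_natr natz.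
  by rewrite rpredBl ?dvdz_mull ?dvdzz.
split=> [dvd_z w w0|dvd_y w]; first by rewrite -zE.
have [->|w_neq0] := eqVneq w ord0; last by rewrite zE ?dvd_y.
move: zZ; rewrite cyc_elt_in_Zn (bigD1 ord0) //= addr_eq0 => /eqP->.
by rewrite rpredN rpred_sum // => v v_neq0; rewrite zE ?dvd_y.
Qed.

Lemma dvd_int_comb_f y :
  (exists2 x, x \in @Zn n & int_comb (f_ n d) y = x *+ d) <->
  (forall a, (d %| class_sum d y a - class_sum d y 0)%Z) /\
  (d0 %| class_sum d y 0)%Z.
Proof.
apply: iff_trans (dvd_window_sums d_gt0 y).
have := @int_comb_in_Zn (f_ n d) y (fun v => f_in_Zn d v (ltn0Sn n')).
rewrite int_comb_f; set z := _ - _ => zZ.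
apply: (iff_trans (cyc_elt_dvd_Zn d_gt0 zZ)).
have zE w : (d %| z w)%Z = (d %| window_sum d y w)%Z.
  by rewrite !ffunE ffunMnE -mulr_natr natz rpredBl ?dvdz_mull ?dvdzz.
by split=> dvd_z w; [rewrite -zE | rewrite zE].
Qed.

Lemma int_comb_eps_eq0 y :
  int_comb (eps_ n d) y = 0 <-> forall v, v != ord0 -> y v = 0.
Proof.
split=> [|y0]; last first.
  rewrite /int_comb big1 // => v _; have [->|/y0->] := eqVneq v ord0.
    by rewrite /eps_ /e_ muln0 expr0 subrr mul0rn subrr mul0rz.
  by rewrite mulr0z.
have [c ->] := int_comb_eps y.
rewrite -(raddf0 (@cyc_elt n')) => /cyc_elt_inj/ffunP y0.
(* Index 0 is left out because of c; since d 0 = 0, it contributes to no other equation. *)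
apply: (@contraction_eq0 _ (predC1 ord0) (fun v => inZp (d * v)) y d) => //.
move=> w /= w_neq0.
have /eqP := y0 w.
rewrite !ffunE ffunMnE (negPf w_neq0) subr0 subr_eq0 => /eqP->.
apply: eq_bigl => v; rewrite -[inZp _ == w]val_eqE /= (modn_small (ltn_ord w)).
have [->|//] := eqVneq v ord0; rewrite muln0 mod0n eq_sym -[LHS]/(w == ord0).
exact: negPf.
Qed.

(** The exponents d v + i run through 0, ..., n d - 1 and so meet each residue modulo n exactly d
    times. *)
Lemma sum_f_eq0 : \sum_(v < n) f_ n d v = 0.
Proof.
rewrite /f_ sumrB -(big_mkord xpredT (fun v => X ^+ v *+ d)).
rewrite -(big_mkord xpredT (fun v => \sum_(0 <= i < d) X ^+ (d * v + i))) /=.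
rewrite -sum_block mulnC sum_block.
have Eper v : \sum_(0 <= i < n) X ^+ (n * v + i) = \sum_(0 <= i < n) X ^+ i.
  by apply: eq_bigr => i _; rewrite exprD exprM cycX_expn // expr1n mul1r.
rewrite (eq_bigr _ (fun v _ => Eper v)) big_const_nat subn0.
by rewrite iter_addr_0 sumrMnl subrr.
Qed.

Lemma int_comb_f_eq0 y :
  int_comb (f_ n d) y = 0 <-> forall v, y v = y ord0.
Proof.
split=> [|yc]; last first.
  have -> : int_comb (f_ n d) y = (\sum_(v < n) f_ n d v) *~ y ord0.
    by rewrite mulrz_suml; apply: eq_bigr => v _; rewrite yc.
  by rewrite sum_f_eq0 mul0rz.
rewrite int_comb_f -(raddf0 (@cyc_elt n')) => /cyc_elt_inj/ffunP y0.
have yE k : y (inZp k) *+ d = window_sum d y k.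
  have /eqP := y0 (inZp k); rewrite !ffunE ffunMnE subr_eq0 => /eqP->.
  by apply: eq_window_sum; rewrite /= modn_mod.
(* [u] is [y] times [X^-1 - 1], and [X - 1] intertwines the window sums with the
   substitution [X |-> X^d]. *)
pose u (v : 'I_n) := y (ordS v) - y v.
have u0 v : u v = 0.
  (* Multiplying d y = y(X^d)(1 + ... + X^(d-1)) by X^-1 - 1 gives d u = X^(d-1) u(X^d), whence the
     exponent d v + d - 1. *)
  pose g (v : 'I_n) : 'I_n := inZp (d * v + d.-1).
  apply: (@contraction_eq0 'I_n xpredT g u d d_gt1) => // w _; rewrite /g.
  (* A natural number standing for w - d modulo n. *)
  pose k := (w + n' * d)%N.
  have kE : k + d = w %[mod n] by rewrite /k -addnA -mulSnr addnC mulnC modnMDl.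
  have wE : w = inZp (k + d) by apply: val_inj; rewrite /= kE modn_small.
  have swE : ordS w = inZp (k.+1 + d).
    apply: val_inj; rewrite /= addSn -(addn1 w) -(addn1 (k + d)).
    by rewrite -[RHS]modnDml kE modnDml.
  rewrite /u mulrnBl swE {1}wE !yE.
  have -> : window_sum d y (k.+1 + d) - window_sum d y (k + d) =
            preim_sum d y (k.+1 + d) - preim_sum d y k.+1.
    by apply/eqP; rewrite subr_eq addrAC eq_sym subr_eq window_sum_shift addrC.
  rewrite sumrB; congr (_ - _).
    rewrite /preim_sum (reindex (@ordS n)) /=; last exact/onW_bij/ordS_bij.
    apply: eq_bigl => v0; rewrite -val_eqE /= modnMmr mulnS addnC eqn_modDr.
    rewrite -[in RHS](modn_small (ltn_ord w)) -kE -(prednK d_gt0).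
    by rewrite addnS -addSn eqn_modDr.
  apply: eq_bigl => v0; rewrite -val_eqE /=.
  rewrite -[in RHS](modn_small (ltn_ord w)) -kE -{4}(prednK d_gt0).
  by rewrite addnS -addSn eqn_modDr.
have yk k : y (inZp k) = y ord0.
  elim: k => [|k <-]; first by congr (y _); apply: val_inj; rewrite /= mod0n.
  have /eqP := u0 (inZp k); rewrite /u subr_eq0 => /eqP <-; congr (y _).
  by apply: val_inj; rewrite /= -[in RHS]addn1 modnDml addn1.
by move=> v; rewrite -(yk v) valZpK.
Qed.

Lemma int_span_eps x : x \in int_span (eps_tuple n d) <->
  exists y : {ffun 'I_n -> int}, x = int_comb (eps_ n d) y.
Proof.
apply: int_span_comb.
by rewrite /eps_ /e_ muln0 expr0 subrr mul0rn subrr rpred0.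
Qed.

Lemma int_span_f x : x \in int_span (f_tuple n d) <->
  exists y : {ffun 'I_n -> int}, x = int_comb (f_ n d) y.
Proof.
(* All f_v add up to 0, so f_0 is minus the sum of the others. *)
apply: int_span_comb; apply/int_spanP; exists [ffun=> -1].
have /eqP := sum_f_eq0; rewrite big_ord_recl addr_eq0 => /eqP->.
rewrite -sumrN; apply: eq_bigr => i _.
by rewrite ffunE (nth_mktuple _ 0 i) mulrNz mulr1z.
Qed.

Lemma int_comb_sub_mul (t : nat -> cycR n) y z :
  int_comb t y = int_comb t z *+ d <-> int_comb t (y - z *+ d) = 0.
Proof.
rewrite raddfB raddfMn /=; split=> [->|/eqP]; first exact: subrr.
by rewrite subr_eq0 => /eqP.
Qed.

(** * The kernel on Sigma(n,d) *)

Lemma n1_shift_ltn (j : 'I_(n - n1)) : (n1 + j < n)%N.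
Proof. by rewrite -ltn_subRL. Qed.

Lemma Sigma_mul_ker : zmod_isog (mul_ker (Sigma n d) d) 'rV[cyc d]_(n - n1).
Proof.
have n1_pos := n1_gt0 n' d.
pose h y : 'rV[cyc d]_(n - n1) :=
  \row_j cyc_int d (y (Ordinal (n1_shift_ltn j))).
apply: (mul_ker_isog (F := int_comb (eps_ n d)) (h := h) d_gt0 int_span_eps
          (fun y => iff_sym (dvd_int_comb_eps y))) => [y z _ _|y Py|b].
- by apply/rowP => j; rewrite !mxE !ffunE cyc_intB.
- split=> [/rowP hy0|[z /int_comb_sub_mul/int_comb_eps_eq0 yz]];
    last first.
    apply/rowP => j; rewrite !mxE; apply/eqP; rewrite cyc_int_eq0 //.
    set v := Ordinal _; have v_neq0 : v != ord0.
      by rewrite -val_eqE /= -lt0n addn_gt0 n1_pos.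
    have /eqP := yz v v_neq0; rewrite !ffunE ffunMnE subr_eq0 => /eqP->.
    by rewrite -mulr_natr natz dvdz_mull ?dvdzz.
  have dvd_hi (v : 'I_n) : (n1 <= v)%N -> (d %| y v)%Z.
    move=> le_v; have lt_j : (v - n1 < n - n1)%N.
      by rewrite ltn_sub2r ?(leq_ltn_trans le_v).
    have /eqP := hy0 (Ordinal lt_j); rewrite !mxE cyc_int_eq0 //.
    by rewrite (_ : Ordinal _ = v) //; apply: val_inj; rewrite /= subnKC.
  (* For 0 < v < n1 the class sum yields divisibility of [y v]; rounding at v = 0 is harmless since
     eps_0 = 0. *)
  exists [ffun v => (y v %/ d)%Z].
  apply/int_comb_sub_mul/int_comb_eps_eq0 => v v_neq0.
  rewrite !ffunE ffunMnE ffunE -mulr_natr natz divzK ?subrr //.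
  case: (leqP n1 v) => [/dvd_hi//|lt_v].
  rewrite -(class_sum_dvd dvd_hi) // Py //.
  by rewrite gtnNdvd // lt0n.
(* The entries from n1 on are read from [b], and all class sums are set to 0, which meets the
   divisibility condition. *)
pose r k : int := oapp (fun j : 'I_(n - n1) => (val (b 0 j))%:Z) 0
  (insub (k - n1)%N).
have [y [yr y0]] := @class_sum_complete n' d (fun=> 0) r.
exists y => [a _|].
  by rewrite -(@eq_class_sum _ _ y (a %% n1)) ?modn_mod // y0 ?ltn_pmod ?dvdz0.
apply/rowP => j; rewrite mxE yr /= ?leq_addr //.
by rewrite /r addKn valK /= cyc_int_surj.
Qed.

(** * The kernel on S(n,d) *)

Lemma int_comb_f_dvd y :
  (exists z, int_comb (f_ n d) y = int_comb (f_ n d) z *+ d) <->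
  exists c, forall v, (d %| y v - c)%Z.
Proof.
split=> [[z /int_comb_sub_mul/int_comb_f_eq0 yz]|[c dvd_y]].
  exists ((y - z *+ d) ord0) => v.
  rewrite -(yz v) !ffunE ffunMnE opprB addrC subrK.
  by rewrite -mulr_natr natz dvdz_mull ?dvdzz.
exists [ffun v => ((y v - c) %/ d)%Z].
apply/int_comb_sub_mul/int_comb_f_eq0 => v.
have yE w : (y - [ffun v => ((y v - c) %/ d)%Z] *+ d) w = c.
  rewrite !ffunE ffunMnE ffunE -mulr_natr natz divzK //.
  by rewrite opprB addrC subrK.
by rewrite !yE.
Qed.

(** Here n1 = n and the classes are single indices, so the condition on y already makes y constant
    modulo d. *)
Lemma Sand_mul_ker_coprime :
  d0 = 1%N -> zmod_isog (mul_ker (Sand n d) d) (cyc 1).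
Proof.
pose h y : cyc 1 := 0.
move=> d01; have n1E : n1 = n by rewrite d01 divn1.
apply: (mul_ker_isog (F := int_comb (f_ n d)) (h := h) d_gt0
  int_span_f (fun y => iff_sym (dvd_int_comb_f y)))
  => [y z _ _|y [Py _]|b].
- by rewrite subr0.
- split=> // _; apply/int_comb_f_dvd; exists (class_sum d y 0) => v.
  suff <- : class_sum d y v = y v by exact: Py.
  rewrite class_sum_split ?n1E ?ltn_ord // big1 ?addr0 // => u /andP[_].
  by move=> le_nu; have := ltn_ord u; rewrite ltnNge le_nu.
exists 0; last exact/esym/ord1.
have S0 a : class_sum d (0 : {ffun 'I_n -> int}) a = 0.
  by rewrite /class_sum big1 // => v _; rewrite ffunE.
by split=> [a|]; rewrite !S0 ?subrr dvdz0.
Qed.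

Lemma n1_shift1_ltn (j : 'I_(n - n1 - 1)) : (n1 + 1 + j < n)%N.
Proof. by rewrite -addnA -!ltn_subRL. Qed.

(** The entry at n1, an index below n because d0 > 1, is subtracted to make the coordinates blind to
    constants: a constant c has class sum c d0 and so shifts both class sum / d0 and this entry by
    c. The class sum counts modulo d, hence its quotient by d0 modulo m. *)
Lemma Sand_mul_ker : (1 < d0)%N ->
  zmod_isog (mul_ker (Sand n d) d) (cyc m * 'rV[cyc d]_(n - n1 - 1))%type.
Proof.
move=> d0_gt1; have d0_pos := ltnW d0_gt1; have n1_pos := n1_gt0 n' d.
have d0_neq0 : d0%:Z != 0 by rewrite -lt0n in d0_pos *.
have n1_ltn : (n1 < n)%N by rewrite ltn_Pdiv.
have m_gt0 : (0 < m)%N.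
  by have := d_gt0; rewrite -{1}(mul_m n' d) muln_gt0 => /andP[].
have dE : d%:Z = m%:Z * d0%:Z by rewrite -PoszM mulnC mul_m.
pose o : 'I_n := Ordinal n1_ltn.
pose h y : cyc m * 'rV[cyc d]_(n - n1 - 1) :=
  (cyc_int m ((class_sum d y 0 %/ d0)%Z - y o),
   \row_j cyc_int d (y (Ordinal (n1_shift1_ltn j)) - y o)).
have subACA (a b c e : int) : a - b - (c - e) = a - c - (b - e).
  by rewrite !opprB addrACA [RHS]addrACA [- b - c]addrC.
have SB a := @class_sum_is_zmod_morphism n' d a.
apply: (mul_ker_isog (F := int_comb (f_ n d)) (h := h) d_gt0 int_span_f
          (fun y => iff_sym (dvd_int_comb_f y)))
  => [y z Py Pz|y Py|[b1 b2]].
- congr (_, _); last first.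
    by apply/rowP => j; rewrite !mxE -cyc_intB !ffunE subACA.
  (* The quotient by d0 is additive here because d0 divides both class sums. *)
  rewrite -cyc_intB SB !ffunE; congr cyc_int.
  case: Py => _ /dvdzP[qy ->]; case: Pz => _ /dvdzP[qz ->].
  by rewrite -mulrBl !mulzK // subACA.
- apply: iff_trans (iff_sym (int_comb_f_dvd y)).
  case: Py => PyS /dvdzP[q Eq].
  split=> [[/eqP hy1 /rowP hy2]|[c dvd_c]]; last first.
    have dvd_d u v : (d %| y u - y v)%Z.
      by rewrite -(subrKA c) rpredD // -opprB rpredN.
    congr (_, _); last first.
      by apply/rowP => j; rewrite !mxE; apply/eqP; rewrite cyc_int_eq0.
    apply/eqP; rewrite cyc_int_eq0 // Eq mulzK // -(subrKA c).
    rewrite rpredD //; last first.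
      by rewrite -opprB rpredN (dvdz_trans _ (dvd_c o)) // dE dvdz_mulr ?dvdzz.
    (* After multiplication by d0 the claim is that d divides the class sum of y - c. *)
    rewrite -(dvdz_mul2r d0_neq0) -dE mulrBl -Eq -[d0%:Z]natz mulr_natr.
    rewrite -(class_sum_const n' d c 0) -SB.
    by apply: rpred_sum => v _; rewrite !ffunE.
  exists (y o).
  rewrite cyc_int_eq0 // Eq mulzK // -(dvdz_mul2r d0_neq0) -dE in hy1.
  rewrite mulrBl -Eq in hy1.
  pose u := y - [ffun=> y o].
  have uE v : u v = y v - y o by rewrite !ffunE.
  have uS a : (d %| class_sum d u a)%Z.
    rewrite SB class_sum_const -mulr_natr natz.
    by rewrite -(subrKA (class_sum d y 0)) rpredD.
  have dvd_hi (v : 'I_n) : (n1 <= v)%N -> (d %| u v)%Z.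
    rewrite leq_eqVlt uE => /orP[/eqP Ev|lt_v].
      by rewrite (_ : v = o) ?subrr ?dvdz0 //; apply: val_inj.
    have lt_j : (v - n1 - 1 < n - n1 - 1)%N.
      by rewrite -!subnDA addn1 ltn_sub2r // (leq_ltn_trans lt_v).
    have /eqP := hy2 (Ordinal lt_j); rewrite !mxE cyc_int_eq0 //.
    rewrite (_ : Ordinal _ = v) //; apply: val_inj.
    by rewrite /= -subnDA addn1 subnKC.
  move=> v; rewrite -uE; case: (leqP n1 v) => [/dvd_hi//|lt_v].
  by rewrite -(class_sum_dvd dvd_hi).
(* The witness vanishes at n1. That index is singled out because truncated subtraction would send it
   to the first entry of [b2]. *)
pose r k : int := oapp (fun j : 'I_(n - n1 - 1) => (val (b2 0 j))%:Z) 0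
  (if (k == n1)%N then None else insub (k - (n1 + 1))%N).
have [y [yr yS]] := @class_sum_complete n' d (fun=> (val b1)%:Z * d0%:Z) r.
have S_y a : class_sum d y a = (val b1)%:Z * d0%:Z.
  by rewrite -(@eq_class_sum _ _ y (a %% n1)) ?modn_mod // yS ?ltn_pmod.
exists y; first by split=> [a|]; rewrite !S_y ?subrr ?dvdz0 ?dvdz_mull ?dvdzz.
have yo : y o = 0 by rewrite yr //= /r eqxx.
congr (_, _); first by rewrite S_y mulzK // yo subr0 cyc_int_surj.
apply/rowP => j; rewrite mxE yo subr0 yr /=; last by rewrite -addnA leq_addr.
by rewrite /r addKn valK gtn_eqF /= ?cyc_int_surj // addn1 addSn ltnS leq_addr.
Qed.

End Kernels.

Close Scope ring_scope.

(** For d0 = 1 the exponent n - n1 - 1 of Z_d is -1; it cancels the factor Z_(d/d0) = Z_d and leaves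
    the trivial group. *)
Theorem theorem4p2 (n d : nat) (hn : 1 <= n) (hd : 2 <= d) :
  let d0 := gcdn n d in
  let n1 := n %/ d0 in
  [/\ zmod_isog (mul_ker (Sigma n d) d) 'rV[cyc d]_(n - n1),
      1 < d0 ->
        zmod_isog (mul_ker (Sand n d) d)
                  (cyc (d %/ d0) * 'rV[cyc d]_(n - n1 - 1))%type
    & d0 = 1 -> zmod_isog (mul_ker (Sand n d) d) (cyc 1)].
Proof.
case: n hn => // n' _ /=; split; first exact: Sigma_mul_ker.
- exact: Sand_mul_ker.
exact: Sand_mul_ker_coprime.
Qed.
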